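(* For every knot grid diagram $G$ with associated oriented Legendrian knot $\vec{\mathcal K}=\vec{\mathcal K}(G)$, the homology classes $\lambda^+(\vec{\mathcal K})$ and $\lambda^-(\vec{\mathcal K})$ in $H_*(\mathit{CK}^-(G))$ are not $U$-torsion: $U^d\lambda^\pm(\vec{\mathcal K})\neq0$ for all integers $d\ge0$ (in particular they are nonzero). Consequently, for every transverse knot $\mathcal T$ the transverse invariant $\theta(\mathcal T)$ is nonzero and not $U$-torsion.
   Context: Grid diagrams. A (planar) grid diagram $G$ of grid number $n$ is an $n\times n$ array of unit squares in the plane, some marked $X$ and some $O$, with exactly one $X$ and one $O$ (in different squares) in every row and column; label them $O_1,\dots,O_n$, $X_1,\dots,X_n$. Horizontal segments from $O$ to $X$ in each row and vertical segments from $X$ to $O$ in each column, verticals over horizontals, give an oriented link diagram; $G$ is a knot grid diagram if it is a knot. On the torus $T^2$ there are horizontal and vertical grid circles. $\mathbf S(G)$ is the set of $n$-tuples of intersection points of horizontal and vertical grid circles with exactly one point on each grid circle. $\mathit{CK}^-(G)$ is the free $\mathbb Z[U_1,\dots,U_n]$-module on $\mathbf S(G)$ whose differential counts, with signs from a fixed sign assignment and weight $\prod U_i^{O_i(r)}$ ($O_i(r)$ = multiplicity of $O_i$ in $r$), the empty rectangles $r\subset T^2$ from $\mathbf x$ to $\mathbf y$ containing no $X$. Its homology is a $\mathbb Z[U]$-module, $U$ acting as any $U_i$. $\vec{\mathcal K}(G)$ is the oriented Legendrian knot whose front is obtained from the planar diagram of $G$ by smoothing northwest and southeast corners, making southwest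 and northeast corners cusps, and rotating $45^\circ$ clockwise. $\mathbf x^+(G)$ (resp. $\mathbf x^-(G)$) is the generator of upper right (resp. lower left) corners of the squares marked $X$; these are cycles, and $\lambda^+(\vec{\mathcal K})$, $\lambda^-(\vec{\mathcal K})$ denote their homology classes. For a transverse knot $\mathcal T$, $\theta(\mathcal T)=\lambda^+(\vec{\mathcal K})$ where $\vec{\mathcal K}=\vec{\mathcal K}(G)$ is a Legendrian approximation of $\mathcal T$. *)

(* Defs.v *)
From HB Require Import structures.
From mathcomp Require Import all_boot all_order all_algebra all_fingroup.
From mathcomp Require Import mpoly.
Set Implicit Arguments. Unset Strict Implicit. Unset Printing Implicit Defensive.
Import GRing.Theory.
Local Open Scope ring_scope.

(* Columns and rows are indexed by 'I_n (0 = leftmost / bottom).        *)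
(* Square (c, r) = column c, row r.  The X in column c sits in row      *)
(* Xr c, the O in column c sits in row Or c.  Since Xr, Or are          *)
(* permutations, every row and every column contains exactly one X and  *)
(* one O.  We label O_c := the O in column c.                           *)
(* Lattice point (p, q) = intersection of vertical grid circle p (the   *)
(* left edge of column p) and horizontal grid circle q (bottom edge of  *)
(* row q) on the torus.                                                 *)

Definition is_grid n (Xr Or : {perm 'I_n}) : Prop := forall c, Xr c != Or c.

(* Following the link: from the O in column c go horizontally (in row
   Or c) to the X of that row, which lies in column Xr^-1 (Or c), then
   vertically to the O of that column.  The diagram is a knot iff this
   column map is a single n-cycle. *)
Definition is_knot n (Xr Or : {perm 'I_n}) : Prop :=
  forall c : 'I_n, #|porbit (Or * Xr^-1)%g c| = n.

(* Generators S(G): one intersection point on each vertical and each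
   horizontal circle, i.e. a permutation x : point (p, x p). *)
Notation gen n := {perm 'I_n}.

Definition cyc_in n (a b c : 'I_n) : bool :=
  ((c + n - a) %% n < (b + n - a) %% n)%N.
Definition cyc_open n (a b c : 'I_n) : bool :=
  (0 < (c + n - a) %% n)%N && ((c + n - a) %% n < (b + n - a) %% n)%N.

(* A rectangle on the torus starting at x: (x, a, b) with a != b.  Its
   lower-left corner is (a, x a), its upper-right corner is (b, x b);
   it covers columns [a, b) and rows [x a, x b) cyclically.  It connects
   x to y = tgt r, which agrees with x except y a = x b, y b = x a.
   Every rectangle connecting two generators is of this form. *)
Definition rect n := (gen n * 'I_n * 'I_n)%type.
Definition rsrc n (r : rect n) : gen n := r.1.1.
Definition rleft n (r : rect n) : 'I_n := r.1.2.
Definition rright n (r : rect n) : 'I_n := r.2.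
Definition rvalid n (r : rect n) : bool := rleft r != rright r.
Definition rtgt n (r : rect n) : gen n := (tperm (rleft r) (rright r) * rsrc r)%g.

Definition rsq n (r : rect n) (c q : 'I_n) : bool :=
  cyc_in (rleft r) (rright r) c &&
  cyc_in (rsrc r (rleft r)) (rsrc r (rright r)) q.

Definition rdom n (r : rect n) (c q : 'I_n) : nat := rsq r c q.

Definition rempty n (r : rect n) : bool :=
  [forall p : 'I_n, ~~ (cyc_open (rleft r) (rright r) p &&
      cyc_open (rsrc r (rleft r)) (rsrc r (rright r)) (rsrc r p))].

Definition rnoX n (Xr : {perm 'I_n}) (r : rect n) : bool :=
  [forall c : 'I_n, ~~ rsq r c (Xr c)].

Definition Omult n (Or : {perm 'I_n}) (r : rect n) (c : 'I_n) : nat :=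
  rsq r c (Or c).

(* Sign assignments (Manolescu-Ozsvath-Szabo-Thurston). *)
Definition vertical_annulus n (D : 'I_n -> 'I_n -> nat) : Prop :=
  exists c1 c2 : 'I_n, c1 != c2 /\ forall c q, D c q = cyc_in c1 c2 c.
Definition horizontal_annulus n (D : 'I_n -> 'I_n -> nat) : Prop :=
  exists q1 q2 : 'I_n, q1 != q2 /\ forall c q, D c q = cyc_in q1 q2 q.

Definition sign_assignment n (S : rect n -> int) : Prop :=
  [/\ (forall r, rvalid r -> S r = 1 \/ S r = -1),
      (forall r1 r2 r3 r4, rvalid r1 -> rvalid r2 -> rvalid r3 -> rvalid r4 ->
         rsrc r2 = rtgt r1 -> rsrc r4 = rtgt r3 ->
         rsrc r1 = rsrc r3 -> rtgt r2 = rtgt r4 ->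
         (forall c q, (rdom r1 c q + rdom r2 c q = rdom r3 c q + rdom r4 c q)%N) ->
         uniq [:: r1; r2; r3; r4] ->
         S r1 * S r2 = - (S r3 * S r4)),
      (forall r1 r2, rvalid r1 -> rvalid r2 ->
         rsrc r2 = rtgt r1 -> rtgt r2 = rsrc r1 ->
         vertical_annulus (fun c q => rdom r1 c q + rdom r2 c q)%N ->
         S r1 * S r2 = -1) &
      (forall r1 r2, rvalid r1 -> rvalid r2 ->
         rsrc r2 = rtgt r1 -> rtgt r2 = rsrc r1 ->
         horizontal_annulus (fun c q => rdom r1 c q + rdom r2 c q)%N ->
         S r1 * S r2 = 1)].

(* The complex CK^-(G): free Z[U_0,...,U_{n-1}]-module on S(G); a chain *)
(* is a function S(G) -> Z[U] (finite support automatically).           *)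
Definition Rpoly n := {mpoly int[n]}.

Definition Umono n (Or : {perm 'I_n}) (r : rect n) : Rpoly n :=
  \prod_(c < n) 'X_c ^+ Omult Or r c.

Definition diffCK n (Xr Or : {perm 'I_n}) (S : rect n -> int)
    (ch : gen n -> Rpoly n) : gen n -> Rpoly n :=
  fun y => \sum_(x : gen n) \sum_(a : 'I_n) \sum_(b : 'I_n |
      [&& rvalid (x, a, b), rempty (x, a, b), rnoX Xr (x, a, b)
        & rtgt (x, a, b) == y])
      (S (x, a, b))%:~R * Umono Or (x, a, b) * ch x.

Definition is_boundary n Xr Or S (z : gen n -> Rpoly n) : Prop :=
  exists ch, forall y, diffCK Xr Or S ch y = z y.

Definition gen_chain n (p : Rpoly n) (x : gen n) : gen n -> Rpoly n :=
  fun y => if y == x then p else 0.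

(* x^-(G): lower left corners of the X squares: points (c, Xr c). *)
Definition xminus n (Xr : {perm 'I_n}) : gen n := Xr.

(* x^+(G): upper right corners of the X squares: points (c+1, Xr c + 1). *)
Lemma xplus_inj n (Xr : {perm 'I_n}) :
  injective (fun p : 'I_n => ordS (Xr (ord_pred p))).
Proof.
move=> p q /ordS_inj /perm_inj; exact: ord_pred_inj.
Qed.
Definition xplus n (Xr : {perm 'I_n}) : gen n := perm (@xplus_inj n Xr).

(* Main.v *)
(* Setting every U_i to 1 and reducing modulo 2, it suffices to find a cochain
   phi : S(G) -> F_2 that vanishes on the boundaries of the complex counting
   empty X-free rectangles and takes the value 1 on x^+ (or x^-).
   Let delta_i be the coboundary counting the empty rectangles which contain
   X_i once and no other X, and delta_0 the one counting X-free rectangles.  The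
   argument for d^2 = 0 shows that delta_0 and delta_i commute modulo 2.  No
   X-free rectangle ends at the generator t of upper left corners of the X's, so
   the indicator of t is a delta_0-cocycle, and stays one under any product of
   the delta_i.  Apply the delta_i of all the X's outside the last column, in
   the order of their rows: exactly one chain of rectangles, each one unit high,
   leads from x^- to t, so the resulting cocycle takes the value 1 on x^-.
   Rotation by 180 degrees exchanges x^- and x^+. *)
Require Import Defs.
From HB Require Import structures.
From mathcomp Require Import all_boot all_order all_algebra all_fingroup.
From mathcomp Require Import mpoly.
From mathcomp Require Import zify ring.
From Stdlib Require Import FunctionalExtensionality.
Set Implicit Arguments. Unset Strict Implicit. Unset Printing Implicit Defensive.
Import GRing.Theory.

(** * Cyclic order on the grid circles *)

(* [c] lies strictly between [a] and [b] on the oriented circle. *)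
Definition cycb (a b c : nat) : bool :=
  [|| a < c < b, c < b < a | b < a < c].

Lemma modn_lt2 n k : k < 2 * n -> k %% n = if k < n then k else k - n.
Proof.
move=> k2; case: ifP => kn; first by rewrite modn_small.
have -> : k = (k - n) + n by lia.
by rewrite modnDr modn_small; lia.
Qed.

Lemma cyc_openE n (a b c : 'I_n) : cyc_open a b c = cycb a b c.
Proof.
rewrite /cyc_open /cycb; have := ltn_ord a; have := ltn_ord b; have := ltn_ord c.
move=> hc hb ha; rewrite !modn_lt2; try lia.
by case: ifP; case: ifP; lia.
Qed.

Lemma cyc_inE n (a b c : 'I_n) : a != b -> cyc_in a b c = (c == a) || cycb a b c.
Proof.
rewrite -(inj_eq val_inj) -[c == a](inj_eq val_inj) /=.
rewrite /cyc_in /cycb; have := ltn_ord a; have := ltn_ord b; have := ltn_ord c.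
move=> hc hb ha; rewrite !modn_lt2; try lia.
by case: ifP; case: ifP; lia.
Qed.

Lemma cyc_in_split n (a b d c : 'I_n) : cycb a b d ->
  cyc_in a b c = cyc_in a d c + cyc_in d b c :> nat.
Proof.
move=> abd.
have [ab ad db] : [/\ a != b, a != d & d != b].
  by split; apply/eqP => e; move: abd; rewrite /cycb e; lia.
move: abd; rewrite !cyc_inE // -!(inj_eq val_inj) /= /cycb.
by have := ltn_ord c; lia.
Qed.

Lemma rempty_forallE n (x : {perm 'I_n}) (a b : 'I_n) : rempty (x, a, b) =
  [forall p : 'I_n, ~~ (cycb a b p && cycb (x a) (x b) (x p))].
Proof. by apply: eq_forallb => p; rewrite /rleft /rright /rsrc /= !cyc_openE. Qed.

Lemma remptyP n (x : {perm 'I_n}) (a b : 'I_n) :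
  reflect (forall p : 'I_n, ~~ (cycb a b p && cycb (x a) (x b) (x p))) (rempty (x, a, b)).
Proof. by rewrite rempty_forallE; exact: forallP. Qed.

Lemma cycb_rot a b c : cycb a b c = cycb b c a.
Proof. by rewrite /cycb; lia. Qed.

Lemma cycbxx a b : (cycb a b a = false) * (cycb a b b = false) * (cycb a a b = false).
Proof. by rewrite /cycb; do !split; lia. Qed.

Lemma cycb_flip a b c : a != b -> a != c -> b != c -> cycb a c b = ~~ cycb a b c.
Proof. by rewrite /cycb; lia. Qed.

Lemma cycb_antisym a b c : cycb a b c ->
  (cycb b c a = true) * (cycb c a b = true) * (cycb a b c = true) *
  (cycb a c b = false) * (cycb c b a = false) * (cycb b a c = false).
Proof. by rewrite /cycb => abc; do !split; lia. Qed.

Lemma cycb_split a b d p : cycb a b d -> p != d ->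
  cycb a b p = cycb a d p || cycb d b p.
Proof. by rewrite /cycb; lia. Qed.

(* The second case is that of crossing chords ab and cd. *)
Lemma cycb_chords (a b c d : nat) :
  a != b -> c != d -> a != c -> a != d -> b != c -> b != d ->
  ((cycb a b c == cycb a b d) && (cycb c d a == cycb c d b)) ||
  [&& cycb a b c != cycb a b d, cycb c d a == cycb a b d & cycb c d b == cycb a b c].
Proof.
move=> ab cd ac ad bc bd; rewrite /cycb.
case: (ltngtP a b) ab => // ? _; case: (ltngtP c d) cd => // ? _;
case: (ltngtP a c) ac => // ? _; case: (ltngtP a d) ad => // ? _;
case: (ltngtP b c) bc => // ? _; case: (ltngtP b d) bd => //= ? _; lia.
Qed.

Lemma cyc_in_ordS n (a b : 'I_n) : a != b -> (forall p : 'I_n, ~~ cycb a b p) -> b = ordS a.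
Proof.
move=> ab h; apply/val_inj => /=; have an := ltn_ord a; have bn := ltn_ord b.
have := h (ordS a); rewrite /cycb /=.
move: ab; rewrite -(inj_eq val_inj) /=.
have [an'|an'] := ltnP a.+1 n; first by rewrite modn_small //; lia.
by have -> : a.+1 = n by [lia]; rewrite modnn; lia.
Qed.

Lemma cycb_ordS n (a p : 'I_n) : ~~ cycb a (ordS a) p.
Proof.
have an := ltn_ord a; have pn := ltn_ord p; rewrite /cycb /=.
have [an'|an'] := ltnP a.+1 n; first by rewrite modn_small //; lia.
by have -> : a.+1 = n by [lia]; rewrite modnn; lia.
Qed.

Lemma cyc_in_compl n (a b e : 'I_n) : a != b -> cyc_in a b e + cyc_in b a e = 1.
Proof.
move=> ab; have ba : b != a by rewrite eq_sym.
rewrite !cyc_inE // -!(inj_eq val_inj) /= /cycb.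
by move: ab; rewrite -(inj_eq val_inj) /=; lia.
Qed.

Lemma cyc_in_left n (a b : 'I_n) : a != b -> cyc_in a b a.
Proof. by move=> ab; rewrite cyc_inE // eqxx. Qed.

Lemma cyc_in_right n (a b : 'I_n) : a != ordS b -> cyc_in a (ordS b) b.
Proof.
move=> ab; rewrite cyc_inE //; have [//|ba] := eqVneq b a => /=.
move: ab ba; rewrite -!(inj_eq val_inj) /= /cycb.
have an := ltn_ord a; have bn := ltn_ord b.
have [bn'|bn'] := ltnP b.+1 n; first by rewrite modn_small //; lia.
by have -> : b.+1 = n by [lia]; rewrite modnn; lia.
Qed.

Lemma cyc_inxx n (a c : 'I_n) : cyc_in a a c = false.
Proof. by rewrite /cyc_in addKn modnn. Qed.

Lemma rsqE n (y : {perm 'I_n}) (a b e q : 'I_n) :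
  rsq (y, a, b) e q = cyc_in a b e * cyc_in (y a) (y b) q :> nat.
Proof. by rewrite mulnb. Qed.

Lemma ordS_eq m (j : 'I_m) : (j == ordS j) = (m == 1%N).
Proof.
rewrite -(inj_eq val_inj) /=; have jm := ltn_ord j.
have [jm'|jm'] := ltnP j.+1 m; first by rewrite modn_small //; lia.
by have e : j.+1 = m by [lia]; rewrite e modnn; lia.
Qed.

Lemma tpermN (T : finType) (u v p : T) : p != u -> p != v -> tperm u v p = p.
Proof. by move=> pu pv; rewrite tpermD // eq_sym. Qed.

(** * Recutting L-shaped domains *)

(* An L-shaped domain with corners in the columns a, b, d can be cut into two
   rectangles in two ways; the cyclic order conditions on the columns and on the
   rows are what identifies the shape from either of its cuts. *)
Section LShape.
Variables (n : nat) (x : {perm 'I_n}) (a b d : 'I_n).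
Hypotheses (ab : a != b) (ad : a != d) (bd : b != d).

Let bad (y : {perm 'I_n}) (u v p : 'I_n) := cycb u v p && cycb (y u) (y v) (y p).

(** The transpositions in play move only the points in columns [a], [b], [d]; all other points are
    common to the generators involved and are handled uniformly. *)
Let remptyE (y : {perm 'I_n}) u v : rempty (y, u, v) =
  [&& ~~ bad y u v a, ~~ bad y u v b, ~~ bad y u v d &
   [forall p, [&& p != a, p != b & p != d] ==> ~~ bad y u v p]].
Proof.
apply/remptyP/and4P => [h|[ha hb hd /forallP h] p].
  by split; try exact: h; apply/forallP => p; apply/implyP => _; exact: h.
have := h p.
have [->//|_] := eqVneq p a; have [->//|_] := eqVneq p b; have [->//|_] := eqVneq p d.
exact.
Qed.

Let forallU (P Q : pred 'I_n) : [forall p, P p] && [forall p, Q p] = [forall p, P p && Q p].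
Proof.
apply/andP/forallP => [[/forallP p /forallP q] i|h]; first by rewrite p q.
by split; apply/forallP => i; case/andP: (h i).
Qed.

Let E := (tpermL, tpermR, permM, cycbxx).
Let ba : b != a. Proof. by rewrite eq_sym. Qed.
Let da : d != a. Proof. by rewrite eq_sym. Qed.
Let db : d != b. Proof. by rewrite eq_sym. Qed.

Let split_col (u v w p : 'I_n) : cycb u v w -> p != w ->
  cycb u v p = cycb u w p || cycb w v p.
Proof. by move=> C pw; apply: cycb_split. Qed.

Let split_row (u v w p : 'I_n) : cycb (x u) (x v) (x w) -> p != w ->
  cycb (x u) (x v) (x p) = cycb (x u) (x w) (x p) || cycb (x w) (x v) (x p).
Proof.
by move=> C pw; apply: cycb_split => //; rewrite (inj_eq val_inj) (inj_eq perm_inj).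
Qed.

Let colN (u v w : 'I_n) : u != v -> u != w -> v != w -> ~~ cycb u v w -> cycb u w v.
Proof. by move=> uv uw vw; rewrite (@cycb_flip u v w). Qed.

Let rowN (u v w : 'I_n) : u != v -> u != w -> v != w ->
  ~~ cycb (x u) (x v) (x w) -> cycb (x u) (x w) (x v).
Proof.
by move=> uv uw vw; rewrite (@cycb_flip (x u) (x v) (x w)) // ?(inj_eq val_inj) ?(inj_eq perm_inj).
Qed.

(** [C] and [S] are the order conditions of the two cuts. If both hold, the intervals split at the
    third corner and emptiness agrees point by point; if only one holds, a corner point lies inside
    a rectangle of its cut. *)
Ltac lshape u v w u' v' w' :=
  let C := fresh "C" in let S := fresh "S" in
  have [C|/colN C] := boolP (cycb u v w);
  have [S|/rowN S] := boolP (cycb (x u') (x v') (x w')) => //=;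
  rewrite !remptyE /bad !E !tpermN //;
  [ rewrite !(cycb_antisym C) !(cycb_antisym S) ?andbF /=;
    rewrite !forallU; apply: eq_forallb => ?; case: and3P => [[? ? ?]|//];
    rewrite /= !E !tpermN // (split_col C) // (split_row S) //;
    by do 4!case: (cycb _ _ _)
  | by rewrite !(cycb_antisym C) // !(cycb_antisym (S _ _ _)) //= ?andbF
  | by rewrite !(cycb_antisym (C _ _ _)) // !(cycb_antisym S) //= ?andbF ].

(** In the left-hand cuts both rectangles start in column [a] (first two lemmas) or both end in
    column [b] (last two); in the right-hand cuts one rectangle ends in the column where the other
    starts. *)
Lemma lshape1 :
  [&& cycb a b d, rempty (x, a, b) & rempty ((tperm a b * x)%g, a, d)] =
  [&& cycb (x a) (x d) (x b), rempty (x, a, d) & rempty ((tperm a d * x)%g, d, b)].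
Proof. lshape a b d a d b. Qed.

Lemma lshape2 :
  [&& cycb a d b, rempty (x, a, b) & rempty ((tperm a b * x)%g, a, d)] =
  [&& cycb (x a) (x d) (x b), rempty (x, b, d) & rempty ((tperm b d * x)%g, a, b)].
Proof. lshape a d b a d b. Qed.

Lemma lshape3 :
  [&& cycb a b d, rempty (x, a, b) & rempty ((tperm a b * x)%g, d, b)] =
  [&& cycb (x d) (x b) (x a), rempty (x, d, b) & rempty ((tperm d b * x)%g, a, d)].
Proof. lshape a b d d b a. Qed.

Lemma lshape4 :
  [&& cycb d b a, rempty (x, a, b) & rempty ((tperm a b * x)%g, d, b)] =
  [&& cycb (x d) (x b) (x a), rempty (x, d, a) & rempty ((tperm d a * x)%g, a, b)].
Proof. lshape d b a d b a. Qed.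
End LShape.

(** * Pairs of successive empty rectangles whose only X is [X_i] *)

Section Square.
Variables (n : nat) (X : {perm 'I_n}) (i : 'I_n) (x : {perm 'I_n}).

(** The content is imposed on the sum of the two domains, so that recutting preserves it; either
    rectangle may be the one through [X_i]. *)
Definition two_step (a b c d : 'I_n) : bool :=
  [&& (a != b) && (c != d), rempty (x, a, b) && rempty ((tperm a b * x)%g, c, d)
    & [forall e, rsq (x, a, b) e (X e) + rsq ((tperm a b * x)%g, c, d) e (X e) == (e == i)]].

Let E := (tpermL, tpermR, permM).
Let two_stepE (g h : bool) (a b c d a' b' c' d' : 'I_n) :
  (a != b) && (c != d) -> (a' != b') && (c' != d') ->
  [&& g, rempty (x, a, b) & rempty ((tperm a b * x)%g, c, d)] =
  [&& h, rempty (x, a', b') & rempty ((tperm a' b' * x)%g, c', d')] ->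
  (g -> h -> forall e q,
    rsq (x, a, b) e q + rsq ((tperm a b * x)%g, c, d) e q =
    rsq (x, a', b') e q + rsq ((tperm a' b' * x)%g, c', d') e q) ->
  g && two_step a b c d = h && two_step a' b' c' d'.
Proof.
rewrite /two_step => -> -> eq_empty eq_dom /=.
rewrite [g && (_ && _)]andbA [h && (_ && _)]andbA eq_empty.
case: (boolP [&& h, _ & _]) eq_empty => //= /and3P[h1 _ _] /and3P[g1 _ _].
by apply: eq_forallb => e; rewrite eq_dom.
Qed.

Section LShape.
Variables (a b d : 'I_n).
Hypotheses (ab : a != b) (ad : a != d) (bd : b != d).
Let ba : b != a. Proof. by rewrite eq_sym. Qed.
Let da : d != a. Proof. by rewrite eq_sym. Qed.
Let db : d != b. Proof. by rewrite eq_sym. Qed.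

Ltac two_step_lshape L :=
  let C := fresh "C" in let S := fresh "S" in
  apply: two_stepE; rewrite ?ab ?ba ?ad ?da ?bd ?db //;
  [ exact: L
  | move=> C S ? ?; rewrite !rsqE !E !tpermN //;
    rewrite !(cyc_in_split _ C) !(cyc_in_split _ S); ring ].

Lemma two_step1 :
  cycb a b d && two_step a b a d = cycb (x a) (x d) (x b) && two_step a d d b.
Proof. two_step_lshape lshape1. Qed.

Lemma two_step2 :
  cycb a d b && two_step a b a d = cycb (x a) (x d) (x b) && two_step b d a b.
Proof. two_step_lshape lshape2. Qed.

Lemma two_step3 :
  cycb a b d && two_step a b d b = cycb (x d) (x b) (x a) && two_step d b a d.
Proof. two_step_lshape lshape3. Qed.

Lemma two_step4 :
  cycb d b a && two_step a b d b = cycb (x d) (x b) (x a) && two_step d a a b.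
Proof. two_step_lshape lshape4. Qed.
End LShape.

(** Only the four corner points can matter. If the chords do not cross in columns or do not cross in
    rows, moving the corners creates no obstruction; crossing in both would put a corner inside one
    of the given empty rectangles. *)
Let rempty_swap (a b c d : 'I_n) : a != b -> c != d ->
  a != c -> a != d -> b != c -> b != d ->
  rempty (x, a, b) && rempty ((tperm a b * x)%g, c, d) ->
  rempty (x, c, d) && rempty ((tperm c d * x)%g, a, b).
Proof.
move=> ab cd ac ad bc bd.
have [ba dc ca da] : [/\ b != a, d != c, c != a & d != a].
  by rewrite ![_ == a]eq_sym [d == c]eq_sym.
have [cb db] : c != b /\ d != b by rewrite ![_ == b]eq_sym.
have nx u v : u != v -> nat_of_ord (x u) != x v.
  by rewrite (inj_eq val_inj) (inj_eq perm_inj).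
have cols := @cycb_chords a b c d ab cd ac ad bc bd.
have rows := @cycb_chords (x a) (x b) (x c) (x d) (nx _ _ ab) (nx _ _ cd)
  (nx _ _ ac) (nx _ _ ad) (nx _ _ bc) (nx _ _ bd).
move=> /andP[/remptyP e1 /remptyP e2].
have /and4P[h1 h2 h3 h4] : [&& ~~ (cycb c d a && cycb (x c) (x d) (x a)),
   ~~ (cycb c d b && cycb (x c) (x d) (x b)), ~~ (cycb a b c && cycb (x a) (x b) (x d))
   & ~~ (cycb a b d && cycb (x a) (x b) (x c))].
  move: (e1 c) (e1 d) (e2 a) (e2 b) cols rows; rewrite !E !tpermN //.
  case: (cycb a b c); case: (cycb a b d); case: (cycb c d a); case: (cycb c d b);
  case: (cycb (x a) (x b) (x c)); case: (cycb (x a) (x b) (x d)) => //=;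
  by case: (cycb (x c) (x d) (x a)); case: (cycb (x c) (x d) (x b)).
apply/andP; split; apply/remptyP => p.
  have [->//|pa] := eqVneq p a; have [->//|pb] := eqVneq p b.
  by have := e2 p; rewrite !E !tpermN.
have [->|pc] := eqVneq p c; first by rewrite !E !tpermN.
have [->|pd] := eqVneq p d; first by rewrite !E !tpermN.
by have := e1 p; rewrite !E !tpermN.
Qed.

Lemma two_stepC (a b c d : 'I_n) : a != b -> c != d ->
  a != c -> a != d -> b != c -> b != d ->
  two_step a b c d = two_step c d a b.
Proof.
move=> ab cd ac ad bc bd.
have [ca da cb db] : [/\ c != a, d != a, c != b & d != b].
  by rewrite ![_ == a]eq_sym ![_ == b]eq_sym.
have := @two_stepE true true a b c d c d a b; rewrite ab cd /=; apply => // [|_ _ e q].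
  by apply/idP/idP; apply: rempty_swap.
by rewrite !rsqE !E !tpermN // addnC.
Qed.

(** The two rectangles fill complementary rows over the same columns. A vertical circle between [a]
    and [b] would carry a point of [x] inside one of them, so the annulus is one column wide, and
    its X identifies the column. *)
Lemma two_step_vertical (a b : 'I_n) :
  two_step a b a b = [&& a != b, a == i & b == ordS i].
Proof.
rewrite /two_step andbb; have [//|/= ab] := eqVneq a b.
have dom e q : rsq (x, a, b) e q + rsq ((tperm a b * x)%g, a, b) e q = cyc_in a b e :> nat.
  by rewrite !rsqE !E -mulnDr cyc_in_compl ?muln1 // (inj_eq perm_inj).
apply/andP/andP => [[/andP[/remptyP e1 /remptyP e2] /forallP c]|[/eqP ai /eqP bi]].
  have bS : b = ordS a.
    apply: (cyc_in_ordS ab) => p.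
    have [->|pa] := eqVneq p a; first by rewrite cycbxx.
    have [->|pb] := eqVneq p b; first by rewrite cycbxx.
    have := e1 p; have := e2 p; rewrite !E !tpermN //.
    rewrite (cycb_rot (x b)) (@cycb_flip (x a) (x b) (x p))
      ?(inj_eq val_inj) ?(inj_eq perm_inj) // 1?eq_sym //.
    by case: (cycb a b p); case: (cycb (x a) _ _).
  have := c a; rewrite dom cyc_inE // eqxx /=.
  by case: (a =P i) => [<- _|//]; rewrite -bS !eqxx.
subst a b; split; first by apply/andP; split; apply/remptyP => p; rewrite (negPf (cycb_ordS _ _)).
by apply/forallP => e; rewrite dom cyc_inE // (negPf (cycb_ordS _ _)) orbF.
Qed.

Lemma two_step_horizontal (a b : 'I_n) :
  two_step a b b a = [&& a != b, x a == X i & x b == ordS (X i)].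
Proof.
rewrite /two_step [b == a]eq_sym andbb; have [//|/= ab] := eqVneq a b.
have xab : x a != x b by rewrite (inj_eq perm_inj).
have dom e q : rsq (x, a, b) e q + rsq ((tperm a b * x)%g, b, a) e q = cyc_in (x a) (x b) q :> nat.
  by rewrite !rsqE !E -mulnDl cyc_in_compl ?mul1n.
apply/andP/andP => [[/andP[/remptyP e1 /remptyP e2] /forallP c]|[/eqP ai /eqP bi]].
  have bS : x b = ordS (x a).
    apply: (cyc_in_ordS xab) => p.
    (* The points of [x] are indexed by columns, so the horizontal circle [p] is named by the column
       of its point. *)
    rewrite -[p](permKV x); move: (x^-1%g p) => {}p.
    have [->|pa] := eqVneq p a; first by rewrite cycbxx.
    have [->|pb] := eqVneq p b; first by rewrite cycbxx.
    have := e1 p; have := e2 p; rewrite !E !tpermN //.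
    rewrite (cycb_rot b) (@cycb_flip a b p) ?(inj_eq val_inj) // 1?eq_sym //.
    by case: (cycb (x a) _ _); case: (cycb a _ _).
  have := c (X^-1%g (x a)); rewrite dom permKV cyc_inE // eqxx /=.
  by case: (_ =P i) => [<- _|//]; rewrite permKV bS !eqxx.
rewrite ai bi in xab dom; split.
  by apply/andP; split; apply/remptyP => p; rewrite ?E ai bi ?(negPf (cycb_ordS _ _)) ?andbF.
by apply/forallP => e; rewrite dom cyc_inE // (negPf (cycb_ordS _ _)) orbF (inj_eq perm_inj).
Qed.
End Square.

(** * Cancellation modulo 2 by recutting *)

Local Open Scope ring_scope.

(** The rank picks one element from each two-element orbit; [f] exchanges the chosen half with the
    other, and the two equal half-sums cancel in characteristic 2. *)
Lemma sum_involution_F2 (T : finType) (P : pred T) (F : T -> 'F_2) (f : T -> T) :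
  (forall q, P q -> [/\ P (f q), f (f q) = q, f q != q & F (f q) = F q]) ->
  \sum_(q | P q) F q = 0.
Proof.
move=> Pf; pose r := @enum_rank T.
rewrite (bigID (fun q => r q < r (f q))%N) /=.
rewrite [X in _ + X](reindex_onto f f) /=; last by move=> q /andP[/Pf[]].
rewrite [X in _ + X](eq_big (fun q => P q && (r q < r (f q))%N) F).
- exact: (addrr_pchar2 (pchar_Fp (isT : prime 2))).
- move=> q; apply/andP/andP => [[/andP[Pq lt_q] /eqP ffq]|[Pq lt_q]].
    have [Pffq _ nffq _] := Pf _ Pq; rewrite ffq in Pffq nffq lt_q.
    split=> //; move: lt_q; rewrite -leqNgt leq_eqVlt => /orP[/eqP/val_inj/enum_rank_inj qf|//].
    by rewrite -qf eqxx in nffq.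
  have [Pfq ffq nfq _] := Pf _ Pq; rewrite Pfq ffq eqxx /=; split=> //.
  by rewrite -leqNgt ltnW.
- by move=> q /andP[/andP[Pq _] /eqP ffq]; have [_ _ _] := Pf _ Pq; rewrite ffq.
Qed.

Lemma tperm_swap (T : finType) (a b c d : T) :
  (tperm a b * tperm c d = tperm (tperm a b c) (tperm a b d) * tperm a b)%g.
Proof. by rewrite -tpermJ conjgE tpermV -!mulgA tperm2 mulg1. Qed.

Section Flip.
Variables (n : nat) (X : {perm 'I_n}) (i : 'I_n) (x : {perm 'I_n}).

Let quad : finType := (('I_n * 'I_n) * ('I_n * 'I_n))%type.

(* Recuts the domain of a pair of rectangles.  A domain from [x] to itself with
   only [X_i] is a thin annulus through [X_i]; the vertical and the horizontal
   one are exchanged. *)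
Definition flip (q : quad) : quad :=
  let: ((a, b), (c, d)) := q in
  if c == a then
    if d == b then
      let a' := x^-1%g (X i) in let b' := x^-1%g (ordS (X i)) in ((a', b'), (b', a'))
    else if cycb a b d then ((a, d), (d, b)) else ((b, d), (a, b))
  else if d == b then
    if cycb a b c then ((c, b), (a, c)) else ((c, a), (a, b))
  else if c == b then
    if d == a then ((i, ordS i), (i, ordS i))
    else if cycb (x a) (x b) (x d) then ((a, d), (a, b)) else ((b, d), (a, d))
  else if d == a then
    if cycb (x a) (x b) (x c) then ((c, b), (a, b)) else ((c, a), (c, b))
  else ((c, d), (a, b)).

Definition squareP (q : quad) : bool :=
  let: ((a, b), (c, d)) := q in two_step X i x a b c d.

Definition squareT (q : quad) : {perm 'I_n} :=
  let: ((a, b), (c, d)) := q in (tperm c d * (tperm a b * x))%g.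

Let flip_spec (q q' : quad) :
  flip q = q' -> flip q' = q -> squareP q' -> q' != q -> squareT q' = squareT q ->
  [/\ squareP (flip q), flip (flip q) = q, flip q != q & squareT (flip q) = squareT q].
Proof. by move=> -> ->. Qed.

Let quad_neq (a b c d a' b' c' d' : 'I_n) : (a != a') || (b != b') ->
  ((a, b), (c, d)) != ((a', b'), (c', d')) :> quad.
Proof. by move=> h; apply/eqP => -[e1 e2 _ _]; rewrite e1 e2 !eqxx in h. Qed.

Ltac tperm_pair :=
  rewrite /squareT !mulgA;
  first [ by rewrite [in LHS]tperm_swap ?(tpermL, tpermR) ?tpermN
        | by rewrite [in RHS]tperm_swap ?(tpermL, tpermR) ?tpermN ].

(** The cases follow the coincidences among the four columns. Each of [two_step1] to [two_step4]
    occurs twice, once in each direction; four distinct columns call for [two_stepC], and the annuli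
    remain. *)
Lemma flipP q : squareP q ->
  [/\ squareP (flip q), flip (flip q) = q, flip q != q & squareT (flip q) = squareT q].
Proof.
case: q => [[a b] [c d]] P; rewrite /squareP in P.
have [ab cd] : a != b /\ c != d by case/and3P: P => /andP[].
have ba : b != a by rewrite eq_sym.
have dc : d != c by rewrite eq_sym.
case: (altP (c =P a)) => [ca|ca].
  subst c; case: (altP (d =P b)) => [db|db].
    subst d; move: P; rewrite two_step_vertical => /and3P[_ /eqP ai /eqP bi].
    subst a b; set a' := x^-1%g (X i); set b' := x^-1%g (ordS (X i)).
    (* By [ordS_eq], distinctness of consecutive rows and of consecutive columns both say that the
       grid number is not 1. *)
    have nx : a' != b' by rewrite (inj_eq perm_inj) ordS_eq -(ordS_eq i).
    apply: (@flip_spec _ ((a', b'), (b', a'))).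
    - by rewrite /flip !eqxx.
    - by rewrite /flip [b' == a']eq_sym (negPf nx) !eqxx.
    - by rewrite /squareP two_step_horizontal nx !permKV !eqxx.
    - by apply/eqP => -[e1 e2 e3 e4]; rewrite e1 e3 eqxx in nx.
    - by rewrite /squareT [tperm b' _]tpermC !mulgA !tperm2.
  have bd : b != d by rewrite eq_sym.
  have [C|C] := boolP (cycb a b d).
    have := two_step1 X i x ab cd bd; rewrite C P andbT => /esym/andP[S P'].
    apply: (@flip_spec _ ((a, d), (d, b))) => //.
    - by rewrite /flip !eqxx (negPf db) C.
    - by rewrite /flip (negPf dc) (negPf bd) eqxx (negPf ba) S.
    - by apply: quad_neq; rewrite db orbT.
    - tperm_pair.
  have C' : cycb a d b by rewrite (@cycb_flip a b d).
  have := two_step2 X i x ab cd bd; rewrite C' P andbT => /esym/andP[S P'].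
  apply: (@flip_spec _ ((b, d), (a, b))) => //.
  - by rewrite /flip !eqxx (negPf db) (negPf C).
  - by rewrite /flip (negPf ab) (negPf bd) (negPf cd) eqxx !(cycb_antisym S).
  - by apply: quad_neq; rewrite ba.
  - tperm_pair.
have ac : a != c by rewrite eq_sym.
case: (altP (d =P b)) => [db|db].
  subst d.
  have [C|C] := boolP (cycb a b c).
    have := two_step3 X i x ab ac dc; rewrite C P andbT => /esym/andP[S P'].
    apply: (@flip_spec _ ((c, b), (a, c))) => //.
    - by rewrite /flip (negPf ca) eqxx C.
    - by rewrite /flip (negPf ac) (negPf cd) (negPf ab) eqxx !(cycb_antisym S).
    - by apply: quad_neq; rewrite ca.
    - tperm_pair.
  have C' : cycb c b a by rewrite -cycb_rot (@cycb_flip a b c).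
  have := two_step4 X i x ab ac dc; rewrite C' P andbT => /esym/andP[S P'].
  apply: (@flip_spec _ ((c, a), (a, b))) => //.
  - by rewrite /flip (negPf ca) eqxx (negPf C).
  - by rewrite /flip (negPf ac) (negPf ba) eqxx (negPf dc) !(cycb_antisym S).
  - by apply: quad_neq; rewrite ca.
  - tperm_pair.
have bd : b != d by rewrite eq_sym.
case: (altP (c =P b)) => [cb|cb].
  subst c; case: (altP (d =P a)) => [da|da].
    subst d; move: P; rewrite two_step_horizontal => /and3P[_ /eqP ai /eqP bi].
    have nS : i != ordS i by rewrite ordS_eq -(ordS_eq (X i)) -bi -ai (inj_eq perm_inj).
    apply: (@flip_spec _ ((i, ordS i), (i, ordS i))).
    - by rewrite /flip (negPf ba) (negPf ab) !eqxx.
    - by rewrite /flip !eqxx -bi -ai !permK.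
    - by rewrite /squareP two_step_vertical nS !eqxx.
    - by apply/eqP => -[e1 e2 e3 _]; rewrite -e1 -e3 eqxx in ab.
    - by rewrite /squareT [tperm b a]tpermC !mulgA !tperm2.
  have ad : a != d by rewrite eq_sym.
  have [S|S] := boolP (cycb (x a) (x b) (x d)).
    have := two_step1 X i x ad ab db; rewrite S P andbT => /andP[C P'].
    apply: (@flip_spec _ ((a, d), (a, b))) => //.
    - by rewrite /flip (negPf ba) (negPf db) eqxx (negPf da) S.
    - by rewrite /flip eqxx (negPf bd) C.
    - by apply: quad_neq; rewrite db orbT.
    - tperm_pair.
  have S' : cycb (x a) (x d) (x b).
    by rewrite (@cycb_flip (x a) (x b) (x d)) // ?(inj_eq val_inj) ?(inj_eq perm_inj).
  have := two_step4 X i x bd ba da; rewrite S' P andbT => /andP[C P'].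
  apply: (@flip_spec _ ((b, d), (a, d))) => //.
  - by rewrite /flip (negPf ba) (negPf db) eqxx (negPf da) (negPf S).
  - by rewrite /flip (negPf ab) eqxx !(cycb_antisym C).
  - by apply: quad_neq; rewrite ba.
  - tperm_pair.
case: (altP (d =P a)) => [da|da]; last first.
  have ad : a != d by rewrite eq_sym.
  have bc : b != c by rewrite eq_sym.
  apply: (@flip_spec _ ((c, d), (a, b))) => //.
  - by rewrite /flip (negPf ca) (negPf db) (negPf cb) (negPf da).
  - by rewrite /flip (negPf ac) (negPf bd) (negPf ad) (negPf bc).
  - by rewrite /squareP -two_stepC.
  - by apply: quad_neq; rewrite ca.
  - tperm_pair.
subst d; have bc : b != c by rewrite eq_sym.
have [S|S] := boolP (cycb (x a) (x b) (x c)).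
  have := two_step3 X i x cb ca ba; rewrite S P andbT => /andP[C P'].
  apply: (@flip_spec _ ((c, b), (a, b))) => //.
  - by rewrite /flip (negPf ca) (negPf ab) (negPf cb) eqxx S.
  - by rewrite /flip (negPf ac) eqxx C.
  - by apply: quad_neq; rewrite ca.
  - tperm_pair.
have S' : cycb (x c) (x b) (x a).
  by rewrite -cycb_rot (@cycb_flip (x a) (x b) (x c)) // ?(inj_eq val_inj) ?(inj_eq perm_inj).
have := two_step2 X i x ca cb ab; rewrite S' P andbT => /andP[C P'].
apply: (@flip_spec _ ((c, a), (c, b))) => //.
- by rewrite /flip (negPf ca) (negPf ab) (negPf cb) eqxx (negPf S).
- by rewrite /flip eqxx (negPf ba) !(cycb_antisym C).
- by apply: quad_neq; rewrite ca.
- tperm_pair.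
Qed.
End Flip.

(** * The coboundaries and their commutation *)

Section Coboundary.
Variables (n : nat) (X : {perm 'I_n}).

Definition admissible (s : pred 'I_n) (x : {perm 'I_n}) (ab : 'I_n * 'I_n) : bool :=
  [&& ab.1 != ab.2, rempty (x, ab.1, ab.2)
    & [forall e, rsq (x, ab.1, ab.2) e (X e) == s e]].

(** [s] prescribes the set of X's met: [pred0] gives [delta_0] and [pred1 i] gives [delta_i]. *)
Definition cobd (s : pred 'I_n) (phi : {perm 'I_n} -> 'F_2) (x : {perm 'I_n}) : 'F_2 :=
  \sum_(ab | admissible s x ab) phi (tperm ab.1 ab.2 * x)%g.

(** Together the two composites sum over all pairs of rectangles with total content [X_i], and
    [flip] cancels these in pairs with the same final generator. *)
Lemma cobdC i phi x :
  cobd pred0 (cobd (pred1 i) phi) x + cobd (pred1 i) (cobd pred0 phi) x = 0.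
Proof.
have cobd2 s t : cobd s (cobd t phi) x =
    \sum_(q : ('I_n * 'I_n) * ('I_n * 'I_n) | admissible s x q.1 &&
        admissible t (tperm q.1.1 q.1.2 * x)%g q.2)
      phi (tperm q.2.1 q.2.2 * (tperm q.1.1 q.1.2 * x))%g.
  by rewrite /cobd pair_big_dep.
have <- : \sum_(q | squareP X i x q) phi (squareT x q) = 0.
  apply: (@sum_involution_F2 _ _ _ (flip X i x)) => q /(@flipP n X i x)[? ? ? ->].
  by split.
(* The pairs are sorted by which of the two rectangles meets [X_i]. *)
rewrite !cobd2 [in RHS](bigID (fun q => admissible pred0 x q.1)) /=.
congr (_ + _); apply: eq_big => -[[a b] [c d]] //=.
  rewrite [RHS]andbC; case: (boolP (admissible pred0 x (a, b))) => //.
  rewrite /admissible /squareP /two_step /= => /and3P[-> -> /forallP e0] /=.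
  case: (c != d) => //=; case: rempty => //=.
  by apply: eq_forallb => e; rewrite (eqP (e0 e)) /=; case: rsq; case: (e == i).
rewrite /admissible /squareP /two_step /=.
case: (a != b); case: (c != d); case: (rempty (x, a, b)) => //=; rewrite ?andbF //.
case: rempty; rewrite /= ?andbF //.
apply/andP/andP => -[/forallP h1 h2].
  move/forallP: h2 => h2; split.
    by apply/forallP => e; rewrite (eqP (h1 e)) (eqP (h2 e)) /= addn0.
  by apply/forallPn; exists i; rewrite (eqP (h1 i)) /= eqxx.
(* The first rectangle is not X-free, and the total content allows it only [X_i]. *)
have ri : rsq (x, a, b) i (X i).
  apply: contraR h2 => ri; apply/forallP => e.
  have [->|ei] := eqVneq e i; first by rewrite (negPf ri).
  by have := h1 e; rewrite (negPf ei); case: rsq.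
split; apply/forallP => e; have := h1 e; have [->|ei] := eqVneq e i; rewrite /= ?eqxx ?(negPf ei) ?ri;
  by do 2?case: rsq.
Qed.
End Coboundary.

(** Terms are added on both sides because subtraction of natural numbers truncates. *)
Lemma sum_tperm (T : finType) (F : T -> T -> nat) (x : {perm T}) (a b : T) : a != b ->
  (\sum_p F p ((tperm a b * x)%g p) + (F a (x a) + F b (x b)) =
   \sum_p F p (x p) + (F a (x b) + F b (x a)))%N.
Proof.
move=> ab; have ba : b != a by rewrite eq_sym.
have split2 (G : T -> nat) :
    (\sum_p G p = G a + (G b + \sum_(p | (p != a) && (p != b)) G p))%N.
  by rewrite (bigD1 a) //= (bigD1 b).
rewrite !split2 !permM tpermL tpermR (eq_bigr (fun p => F p (x p))) //.
  by move: (\sum_(_ | _) _)%N (F a (x b)) (F b (x a)) (F a (x a)) (F b (x b)) => *; lia.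
by move=> p /andP[pa pb]; rewrite permM tpermD // eq_sym.
Qed.

Lemma cobd0 n (X : {perm 'I_n}) s phi x : (forall y, phi y = 0) -> cobd X s phi x = 0.
Proof. by move=> phi0; apply: big1. Qed.

(** * The cocycle for a grid with an X in its top right square *)

Section Descent.
Variables (n : nat) (X : {perm 'I_n.+1}).
Hypothesis Xmax : X ord_max = ord_max.

Definition upper_left : {perm 'I_n.+1} := (X * perm (@ordS_inj _))%g.

Lemma upper_leftE p : upper_left p = ordS (X p).
Proof. by rewrite permM permE. Qed.

(* The column of the X in row [k]; a junk value if [n < k]. *)
Definition col_of (k : nat) : 'I_n.+1 := X^-1%g (inord k).

Fixpoint descent (k : nat) : {perm 'I_n.+1} -> 'F_2 :=
  if k is k'.+1 then cobd X (pred1 (col_of k')) (descent k')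
  else fun x => (x == upper_left)%:R.

Lemma col_ofE k e : (k < n.+1)%N -> (e == col_of k) = (X e == k :> nat).
Proof.
move=> kn; rewrite /col_of -(inj_eq (@perm_inj _ X)) permKV -(inj_eq val_inj) /=.
by rewrite inordK.
Qed.

(** By [cobdC], applying [delta_i] to a [delta_0]-cocycle yields another one; the base case is that
    no X-free rectangle ends at [upper_left]. *)
Lemma descent_cocycle k x : cobd X pred0 (descent k) x = 0.
Proof.
elim: k x => [|k IHk] x /=.
  apply: big1 => -[a b] adm; case: (_ =P upper_left) => // e.
  (* The upper left square of a rectangle ending at [upper_left] carries the X of column [a]. *)
  move: adm => /and3P[/= ab _ /forallP/(_ a)].
  have xE : x = (tperm a b * upper_left)%g by rewrite -e mulgA tperm2 mul1g.
  have xa : x a = ordS (X b) by rewrite xE permM tpermL upper_leftE.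
  have xb : x b = ordS (X a) by rewrite xE permM tpermR upper_leftE.
  rewrite /rsq /rsrc /rleft /rright /= xa xb cyc_in_left //= cyc_in_right //.
  by rewrite -xa -xb (inj_eq perm_inj).
have := cobdC X (col_of k) (descent k) x.
by rewrite [X in _ + X]cobd0 ?addr0.
Qed.

(* Along the rectangles counted by [descent], [height] drops by at most 1, and by
   exactly 1 only if the rectangle does not wrap around the torus; in that case
   no [above j] increases. *)
Definition below (p q : 'I_n.+1) : nat := \sum_(c < n.+1) ((c < p) && (X c < q))%N.
Definition height (x : {perm 'I_n.+1}) : nat := \sum_p below p (x p).
Definition above (j : nat) (x : {perm 'I_n.+1}) : nat := \sum_p (j <= x p)%N * p.

(** By [sum_tperm] the drop of [height] is a sum over the X's. For a rectangle that does not wrap it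
    counts the X's inside, here one; for one that wraps in a single direction every term is at most
    0. *)
Lemma height_step i x a b : i != ord_max -> admissible X (pred1 i) x (a, b) ->
  (height x <= (height (tperm a b * x)%g).+1)%N /\
  (height x = (height (tperm a b * x)%g).+1 -> (a < b)%N /\ (x a < x b)%N).
Proof.
move=> im /and3P[/= ab _ /forallP content].
have xab : x a != x b by rewrite (inj_eq perm_inj).
have := sum_tperm below x ab; rewrite -!/(height _) => swap.
have content' c : [|| c == a, a < c < b, c < b < a | b < a < c]%N &&
   [|| X c == x a, x a < X c < x b, X c < x b < x a | x b < x a < X c]%N = (c == i).
  by have := eqP (content c); rewrite /rsq /rsrc /rleft /rright /= !cyc_inE.
(* A rectangle wrapping in both directions would contain the top right square, whose X is not
   [X_i]. *)
have corner : ((a < b) || (x a < x b))%N.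
  have := content' ord_max; rewrite Xmax [_ == i]eq_sym (negPf im).
  have := ltn_ord a; have := ltn_ord b; have := ltn_ord (x a); have := ltn_ord (x b).
  move: ab xab; rewrite -!(inj_eq val_inj) /=.
  move: (nat_of_ord a) (nat_of_ord b) (nat_of_ord (x a)) (nat_of_ord (x b)) => *.
  lia.
have le1 (c : 'I_n.+1) : ((c < a) && (X c < x a) + ((c < b) && (X c < x b)) <=
   ((c < a) && (X c < x b)) + ((c < b) && (X c < x a)) + (c == i))%N.
  rewrite -content'; move: corner; rewrite -!(inj_eq val_inj) /=.
  move: (nat_of_ord (x a)) (nat_of_ord (x b)) (nat_of_ord (X c)) => xa xb xc.
  by move: (nat_of_ord a) (nat_of_ord b) (nat_of_ord c) => ? ? ?; lia.
have le0 (c : 'I_n.+1) : ~~ ((a < b) && (x a < x b))%N ->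
  ((c < a) && (X c < x a) + ((c < b) && (X c < x b)) <=
   ((c < a) && (X c < x b)) + ((c < b) && (X c < x a)))%N.
  move: corner; move: (nat_of_ord (x a)) (nat_of_ord (x b)) (nat_of_ord (X c)) => xa xb xc.
  by move: (nat_of_ord a) (nat_of_ord b) (nat_of_ord c) => ? ? ?; lia.
have sum1 : (\sum_(c < n.+1) (c == i) = 1)%N.
  by rewrite (bigD1 i) //= eqxx big1 // => c /negPf ->.
have sum_le1 : (below a (x a) + below b (x b) <= below a (x b) + below b (x a) + 1)%N.
  by rewrite -sum1 -!big_split; apply: leq_sum => c _; exact: le1.
have sum_le0 : ~~ ((a < b) && (x a < x b))%N ->
    (below a (x a) + below b (x b) <= below a (x b) + below b (x a))%N.
  by move=> h; rewrite -!big_split; apply: leq_sum => c _; exact: le0.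
move: swap sum_le1 sum_le0.
move: (below _ _) (below _ _) (below _ _) (below _ _) (height x) (height _) => A B C D E F swap le_1 le_0.
split; first by lia.
by move=> eqEF; apply/andP; apply: contraT => /le_0; lia.
Qed.

(** If line [j] separates the two rows, the only counted point moves left from column [b] to column
    [a]; otherwise both or neither are counted and the sum is unchanged. *)
Lemma above_step j (x : {perm 'I_n.+1}) (a b : 'I_n.+1) :
  (a < b)%N -> (x a < x b)%N ->
  (above j (tperm a b * x)%g + (x a < j <= x b) <= above j x)%N.
Proof.
move=> lt_ab lt_xab; have ab : a != b by rewrite -(inj_eq val_inj) /=; lia.
have := sum_tperm (fun (p q : 'I_n.+1) => (j <= q)%N * p)%N x ab; rewrite -!/(above j _).
case: (leqP j (x a)); case: (leqP j (x b)) => /=; rewrite ?mul1n ?mul0n; lia.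
Qed.

(** A nonzero value comes from a chain of [k] rectangles to [upper_left], each lowering [height] by
    at most 1. Equality forces every step to be planar, and then [above_step] applies throughout. *)
Lemma descent_neq0 k y : (k <= n)%N -> descent k y != 0 ->
  (height y <= height upper_left + k)%N /\
  (height y = (height upper_left + k)%N ->
   forall j, (above j upper_left <= above j y)%N).
Proof.
elim: k y => [|k IHk] y kn /=.
  by case: (y =P _) => [-> _|_]; rewrite ?addn0 ?eqxx.
move=> nz; have [[a b] adm nz'] : exists2 ab, admissible X (pred1 (col_of k)) y ab &
    descent k (tperm ab.1 ab.2 * y)%g != 0.
  apply/exists_inP; apply: contraR nz => /exists_inPn h.
  by apply/eqP; apply: big1 => ab /h; rewrite negbK => /eqP.
have km : col_of k != ord_max.
  by rewrite eq_sym col_ofE ?Xmax //= 1?neq_ltn ?kn ?orbT //; lia.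
have [step planar] := height_step km adm.
have [le_k eq_k] := IHk _ (ltnW kn) nz'; rewrite /= in le_k eq_k.
split; first by lia.
move=> eq_y j; have [] := planar _; first by lia.
move=> lt_ab lt_yab; have := above_step j lt_ab lt_yab.
by apply: leq_trans; apply: leq_trans (leq_addr _ _); apply: eq_k; lia.
Qed.

(* The chain from x^- to [upper_left], read backwards: the point in the last
   column is at height [k]. *)
Fixpoint stair (k : nat) : {perm 'I_n.+1} :=
  if k is k'.+1 then (tperm (col_of k') ord_max * stair k')%g else upper_left.

Lemma X_lt c : c != ord_max -> (X c < n)%N.
Proof.
rewrite -(inj_eq (@perm_inj _ X)) Xmax -(inj_eq val_inj) /= => cn.
by rewrite ltn_neqAle cn -ltnS ltn_ord.
Qed.

Lemma col_of_neq k : (k < n)%N -> col_of k != ord_max.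
Proof. by move=> kn; rewrite eq_sym col_ofE ?Xmax /= ?ltnS 1?ltnW // neq_ltn kn orbT. Qed.

Lemma X_col_of k : (k < n.+1)%N -> X (col_of k) = k :> nat.
Proof. by move=> kn; apply/eqP; rewrite -col_ofE. Qed.

(** The points for the X's in rows below [k] have come down from the upper left to the lower left
    corner, which frees line [k] for the last column. *)
Lemma stairE k c : (k <= n)%N ->
  stair k c = (if c == ord_max then k else X c + (k <= X c))%N :> nat.
Proof.
elim: k c => [|k IHk] c kn /=.
  rewrite upper_leftE; have [->|cm] := eqVneq c ord_max; first by rewrite Xmax /= modnn.
  by rewrite /= addn1 modn_small // ltnS X_lt.
have kn' := ltnW kn; have km := col_of_neq kn.
rewrite permM; case: tpermP => [->|->|/eqP ck /eqP cm].
- by rewrite IHk // eqxx (negPf km) X_col_of ?ltnS // ltnn addn0.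
- by rewrite IHk // eqxx (negPf km) X_col_of ?ltnS // leqnn addn1.
rewrite IHk // (negPf cm); move: ck; rewrite col_ofE ?ltnS //.
by rewrite [in RHS]ltn_neqAle [k == _]eq_sym => ->.
Qed.

(** Each step of the staircase is a planar strip with one X, so the bound of [descent_neq0] is
    attained. *)
Lemma height_stair k : (k <= n)%N -> height (stair k) = (height upper_left + k)%N.
Proof.
elim: k => [|k IHk] kn; first by rewrite addn0.
have km := col_of_neq kn; have kn' := ltnW kn.
have /= := sum_tperm below (stair k) km; rewrite -!/(height _) IHk //.
set s := stair k; set m := col_of k.
have sm : s m = k.+1 :> nat by rewrite stairE // (negPf km) X_col_of // leqnn addn1.
have smax : s ord_max = k :> nat by rewrite stairE // eqxx.
suff -> : (below m (s ord_max) + below ord_max (s m) =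
           below m (s m) + below ord_max (s ord_max) + 1)%N.
  by move: (below _ _ + below _ _)%N => A; lia.
have <- : (\sum_(c < n.+1) (c == m) = 1)%N.
  by rewrite (bigD1 m) //= eqxx big1 // => c /negPf ->.
rewrite -!big_split; apply: eq_bigr => c _; rewrite sm smax /=.
have mn : (m < n)%N by rewrite ltn_neqAle -ltnS ltn_ord andbT.
have : (c == m) = (X c == k :> nat) by rewrite col_ofE.
by rewrite -(inj_eq val_inj) /=; lia.
Qed.

(** The rectangle is one row high, hence empty, and the single X of row [k] is in its leftmost
    square. *)
Lemma admissible_stair k : (k < n)%N ->
  admissible X (pred1 (col_of k)) (stair k.+1) (col_of k, ord_max).
Proof.
move=> kn; have km := col_of_neq kn; have kn' : (k < n.+1)%N := ltnW kn.
have rowk : stair k.+1 (col_of k) = k :> nat.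
  by rewrite stairE // (negPf km) X_col_of ?ltnn ?addn0 //.
have rowm : stair k.+1 ord_max = k.+1 :> nat by rewrite stairE // eqxx.
rewrite /admissible /fst /snd km andTb; apply/andP; split.
  by apply/remptyP => p; rewrite /= rowk rowm /cycb; lia.
apply/forallP => e; rewrite /rsq /rsrc /rleft /rright /fst /snd.
have -> : cyc_in (stair k.+1 (col_of k)) (stair k.+1 ord_max) (X e) = (e == col_of k).
  rewrite cyc_inE ?(inj_eq perm_inj) // col_ofE // -(inj_eq val_inj).
  by move: rowk rowm => /= -> ->; rewrite /cycb; lia.
by rewrite /=; case: (e =P _) => [->|]; rewrite ?andbF // cyc_in_left.
Qed.

(** Extremal height makes the rectangle planar and keeps it from crossing line [k.+2]. It contains
    the X of row [k], so its top is line [k.+1], whose point is in the last column; the content then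
    determines the left edge. *)
Lemma descent_unique k a b : (k < n)%N ->
  admissible X (pred1 (col_of k)) (stair k.+1) (a, b) ->
  descent k (tperm a b * stair k.+1)%g != 0 -> (a, b) = (col_of k, ord_max).
Proof.
move=> kn adm nz; have km := col_of_neq kn; have kn' : (k < n.+1)%N := ltnW kn.
have [step planar] := height_step km adm.
have [le_k eq_k] := descent_neq0 (ltnW kn) nz.
rewrite height_stair // in step planar.
have [lt_ab lt_y] := planar ltac:(lia).
have {}eq_k := eq_k ltac:(lia) k.+2.
have := above_step k.+2 lt_ab lt_y.
(* The two generators differ only in points below line [k.+2], so [above] has no room to drop. *)
have -> : above k.+2 (stair k.+1) = above k.+2 upper_left.
  apply: eq_bigr => p _; congr (_ * _)%N; congr nat_of_bool.
  rewrite !(stairE _ kn) -[upper_left]/(stair 0) stairE //.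
  by case: eqP => _; lia.
case/and3P: adm => ab _ /forallP content; rewrite /fst /snd in ab content.
have am : a != ord_max by rewrite -(inj_eq val_inj) /=; have := ltn_ord b; lia.
have ya := stairE a kn; rewrite (negPf am) in ya.
have ym := stairE ord_max kn; rewrite eqxx in ym.
move: (content (col_of k)) (content a).
rewrite /rsq /rsrc /rleft /rright /fst /snd !cyc_inE ?(inj_eq perm_inj) // !eqxx.
move: (stair k.+1) lt_y ya ym {step planar nz content} eq_k => y lt_y ya ym eq_k.
rewrite -(inj_eq val_inj _ (y a)) -(inj_eq val_inj (X a)) /=.
rewrite X_col_of // eqxx /cycb => content_k content_a no_cross.
(* The left corner is at or below line [k], where the points of the staircase are lower left corners
   of X's; the square at this corner therefore carries an X, which must be that of row [k]. *)
have Xa : y a = X a :> nat by lia.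
have aE : a = col_of k.
  by apply/eqP; move: content_a; rewrite Xa eqxx /=; case: (a == _).
rewrite aE X_col_of // in Xa.
by congr (_, _) => //; apply: (@perm_inj _ y); apply: val_inj => /=; rewrite aE in lt_y eq_k no_cross *; lia.
Qed.

Lemma descent_stair k : (k <= n)%N -> descent k (stair k) = 1.
Proof.
elim: k => [|k IHk] kn; first by rewrite /= eqxx.
rewrite [descent _]/= /cobd (bigD1 (col_of k, ord_max)) ?admissible_stair //=.
rewrite mulgA tperm2 mul1g IHk ?(ltnW kn) // big1 ?addr0 // => -[a b] /andP[adm].
by apply: contraNeq => nz; rewrite (descent_unique kn adm nz).
Qed.

Lemma normalized_cocycle :
  exists2 phi, forall x, cobd X pred0 phi x = 0 & phi X = 1.
Proof.
exists (descent n); first exact: descent_cocycle.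
(* The X's outside the last column lie in rows below [n], so all of them have come down. *)
suff -> : X = stair n by exact: descent_stair.
apply/permP => c; apply: val_inj => /=; rewrite stairE //.
by have [->|/X_lt cn] := eqVneq c ord_max; rewrite ?Xmax // leqNgt cn addn0.
Qed.
End Descent.

(** * Translations and the half-turn of the torus *)

Lemma val_addZ n (p d : 'I_n.+1) :
  (p + d : 'I_n.+1) = (if p + d < n.+1 then p + d else p + d - n.+1)%N :> nat.
Proof. by rewrite /= modn_lt2 //; have := ltn_ord p; have := ltn_ord d; lia. Qed.

Lemma cycb_shift n (d a b c : 'I_n.+1) :
  cycb (a + d)%R (b + d)%R (c + d)%R = cycb a b c.
Proof.
have := ltn_ord a; have := ltn_ord b; have := ltn_ord c; have := ltn_ord d.
by rewrite !val_addZ /cycb; do 3!case: ifP; lia.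
Qed.

Lemma cyc_in_shift n (d a b c : 'I_n.+1) : cyc_in (a + d) (b + d) (c + d) = cyc_in a b c.
Proof.
have [->|ab] := eqVneq a b; first by rewrite !cyc_inxx.
by rewrite !cyc_inE ?cycb_shift ?(inj_eq (addIr d)).
Qed.

Lemma val_oppZ n (p : 'I_n.+1) : (- p : 'I_n.+1) = (if p == 0%N :> nat then 0 else n.+1 - p)%N :> nat.
Proof.
rewrite /= modn_lt2; last by lia.
by case: eqP => [->|] //; have := ltn_ord p; case: ifP; lia.
Qed.

Lemma cycb_opp n (a b c : 'I_n.+1) :
  cycb (- b)%R (- a)%R (- c)%R = cycb a b c.
Proof.
have := ltn_ord a; have := ltn_ord b; have := ltn_ord c.
by rewrite !val_oppZ /cycb; do 3!case: eqP; lia.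
Qed.

Lemma cyc_in_rev n (a b c : 'I_n.+1) : cyc_in (- b) (- a) (rev_ord c) = cyc_in a b c.
Proof.
have [->|ab] := eqVneq a b; first by rewrite !cyc_inxx.
have ba : - b != - a by rewrite (inj_eq oppr_inj) eq_sym.
move: (val_oppZ a) (val_oppZ b) ba; move: (- a) (- b) => a' b' va vb ba.
rewrite !cyc_inE // -!(inj_eq val_inj) /= subSS; move: ab ba va vb.
have := ltn_ord a; have := ltn_ord b; have := ltn_ord c.
by rewrite -!(inj_eq val_inj) /= /cycb; case: (nat_of_ord a =P 0%N); case: (nat_of_ord b =P 0%N); lia.
Qed.

(** A symmetry acts by [f] on generators and by [g] on the column pairs of rectangles; cocycles pull
    back along it. *)
Lemma cobd_transport n (X X' : {perm 'I_n}) s s' f g phi x : injective g ->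
  (forall ab, admissible X' s' (f x) (g ab) = admissible X s x ab) ->
  (forall ab, f (tperm ab.1 ab.2 * x)%g = (tperm (g ab).1 (g ab).2 * f x)%g) ->
  cobd X s (phi \o f) x = cobd X' s' phi (f x).
Proof.
move=> g_inj adm tgt; rewrite /cobd [RHS](reindex_inj g_inj) /=.
by apply: eq_big => [ab|ab _]; rewrite /= ?adm ?tgt.
Qed.

(** The far edge of square [p] becomes the near edge of the rotated square. *)
Lemma opp_ordS n (p : 'I_n.+1) : - ordS p = rev_ord p.
Proof.
apply: ord_inj; rewrite val_oppZ /= subSS; have lt_p := ltn_ord p.
have [pn|pn] := ltnP p.+1 n.+1; first by rewrite modn_small //; lia.
by have e : p.+1 = n.+1 by [lia]; rewrite e modnn eqxx; lia.
Qed.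

Lemma ord_pred_opp n (p : 'I_n.+1) : ord_pred (- p) = rev_ord p.
Proof.
by apply: (@ordS_inj _); rewrite ord_predK; apply: oppr_inj; rewrite opprK opp_ordS rev_ordK.
Qed.

Section Existence.
Variable n : nat.
Implicit Types X x : {perm 'I_n.+1}.

Lemma xminus_cocycle X :
  exists2 phi, forall x, cobd X pred0 phi x = 0 & phi (xminus X) = 1.
Proof.
(* The vertical translation by [d] brings the X of the last column to the top row. *)
pose d : 'I_n.+1 := ord_max - X ord_max.
pose V := perm (addIr d).
have [|phi phi0 phi1] := @normalized_cocycle n (X * V)%g.
  by rewrite permM permE /d addrC subrK.
exists (fun x => phi (x * V)%g) => // x.
rewrite -(phi0 (x * V)%g).
apply: (@cobd_transport _ _ _ _ _ (fun x => (x * V)%g) id phi) => // -[a b].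
  rewrite /admissible /= !rempty_forallE /rsq /rsrc /rleft /rright /=.
  congr [&& _, _ & _]; apply: eq_forallb => e; rewrite !permM !permE.
    by rewrite !cycb_shift.
  by rewrite !cyc_in_shift.
by rewrite /= mulgA.
Qed.

(* The rotation by 180 degrees sends the grid line [p] to [- p], but the column
   (or row) of squares [c] to [rev_ord c]. *)
Lemma xplus_cocycle X :
  exists2 phi, forall x, cobd X pred0 phi x = 0 & phi (xplus X) = 1.
Proof.
pose N : {perm 'I_n.+1} := perm oppr_inj.
pose R : {perm 'I_n.+1} := perm rev_ord_inj.
pose f x := (N * x * N)%g.
have NK : (N * N = 1)%g by apply/permP => p; rewrite !permE /= !permE opprK.
have fE x p : f x (- p) = - x p by rewrite !permM !permE opprK.
have [phi phi0 phi1] := xminus_cocycle (R * X * R)%g.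
exists (phi \o f) => [x|]; last first.
  rewrite /= -phi1; congr phi; apply/permP => p.
  by rewrite !permM !permE ord_pred_opp opp_ordS.
rewrite -(phi0 (f x)).
(* Rotation exchanges the left and right edges of a rectangle, hence the reversed pair. *)
apply: (@cobd_transport _ _ _ _ _ f (fun ab => (- ab.2, - ab.1))) => [|[a b]|[a b]].
- by move=> [a b] [c d] /eqP; rewrite xpair_eqE !(inj_eq oppr_inj) => /andP[/eqP /= -> /eqP /= ->].
- rewrite /admissible /= !rempty_forallE /rsq /rsrc /rleft /rright /= !fE.
  rewrite (inj_eq oppr_inj) eq_sym; congr [&& _, _ & _].
    apply/forallP/forallP => h p; first by have := h (- p); rewrite fE !cycb_opp.
    by have := h (- p); rewrite -[p]opprK fE !cycb_opp opprK.
  apply/forallP/forallP => h p.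
    by have := h (rev_ord p); rewrite !permM !permE rev_ordK !cyc_in_rev.
  by have := h (rev_ord p); rewrite !permM !permE -[p]rev_ordK !cyc_in_rev rev_ordK.
- have NV : (N^-1 = N)%g by apply/eqP; rewrite eq_invg_mul NK.
  have -> : tperm (- (a, b).2) (- (a, b).1) = (tperm a b ^ N)%g.
    by rewrite tpermJ !permE tpermC.
  by rewrite /f conjgE NV !mulgA -[(_ * N * N)%g]mulgA NK mulg1.
Qed.
End Existence.

(** * Reduction to counting modulo 2 *)

Section Reduction.
Variables (n : nat) (X O : {perm 'I_n}) (S : rect n -> int).

Definition reduce (p : Rpoly n) : 'F_2 := (p.@[fun _ => 1])%:~R.

Lemma admissible0 x a b : admissible X pred0 x (a, b) =
  [&& rvalid (x, a, b), rempty (x, a, b) & rnoX X (x, a, b)].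
Proof.
by congr [&& _, _ & _]; apply: eq_forallb => e; rewrite /= eqbF_neg.
Qed.

Lemma reduce_sum (I : finType) (P : pred I) (F : I -> Rpoly n) :
  reduce (\sum_(i | P i) F i) = \sum_(i | P i) reduce (F i).
Proof. by rewrite /reduce [meval _ _]rmorph_sum rmorph_sum. Qed.

Lemma reduceM p q : reduce (p * q) = reduce p * reduce q.
Proof. by rewrite /reduce !rmorphM. Qed.

Lemma reduce_Umono r : reduce (Umono O r) = 1.
Proof.
rewrite /reduce /Umono [meval _ _]rmorph_prod rmorph_prod big1 // => c _.
by rewrite rmorphXn /= mevalXU expr1n.
Qed.

Lemma reduce_diffCK ch y :
  (forall r, rvalid r -> S r = 1 \/ S r = -1) ->
  reduce (diffCK X O S ch y) =
  \sum_x \sum_(ab | admissible X pred0 x ab && ((tperm ab.1 ab.2 * x)%g == y))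
     reduce (ch x).
Proof.
move=> S1; rewrite reduce_sum; apply: eq_bigr => x _.
rewrite reduce_sum -(pair_big_dep xpredT (fun a b => admissible X pred0 x (a, b) &&
  ((tperm a b * x)%g == y)) (fun _ _ => reduce (ch x))) /=.
apply: eq_bigr => a _; rewrite reduce_sum.
apply: eq_big => [b|b /andP[val_r _]]; first by rewrite admissible0 /rtgt -!andbA.
rewrite !reduceM reduce_Umono mulr1.
suff -> : reduce (S (x, a, b))%:~R = 1 by rewrite mul1r.
by rewrite /reduce rmorph_int; case: (S1 _ val_r) => ->; apply/val_inj.
Qed.

(** Pairing [phi] with the reduced boundary gives 1 when computed on [z], but 0 when the
    differential is moved onto [phi]. *)
Lemma not_boundary phi x0 z : (forall r, rvalid r -> S r = 1 \/ S r = -1) ->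
  (forall x, cobd X pred0 phi x = 0) -> phi x0 = 1 ->
  reduce (z x0) = 1 -> (forall y, y != x0 -> z y = 0) ->
  ~ is_boundary X O S z.
Proof.
move=> S1 phi0 phi1 zx0 z0 [ch dch].
have : \sum_y phi y * reduce (diffCK X O S ch y) = 1.
  rewrite (bigD1 x0) //= dch zx0 phi1 mulr1 big1 ?addr0 // => y yx0.
  by rewrite dch z0 // /reduce !rmorph0 mulr0.
(* Exchanging the sums over source and target turns the differential of [ch] into the coboundary of
   [phi]. *)
rewrite (eq_bigr (fun y => \sum_x \sum_(ab | admissible X pred0 x ab &&
  ((tperm ab.1 ab.2 * x)%g == y)) reduce (ch x) * phi y)); last first.
  move=> y _; rewrite reduce_diffCK // mulrC mulr_suml.
  by apply: eq_bigr => x _; rewrite mulr_suml.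
rewrite exchange_big /= big1 => [/eqP|x _]; first by rewrite eq_sym oner_eq0.
transitivity (reduce (ch x) * cobd X pred0 phi x); last by rewrite phi0 mulr0.
rewrite mulr_sumr.
rewrite (exchange_big_dep (admissible X pred0 x)) /=; last by move=> ? ? _ /andP[].
apply: eq_bigr => ab adm; rewrite (eq_bigl (pred1 (tperm ab.1 ab.2 * x)%g)) ?big_pred1_eq //.
by move=> y; rewrite adm /= eq_sym.
Qed.
End Reduction.

(** * The corner generators are cycles and are not [U]-torsion *)

Lemma no_outgoing n (X : {perm 'I_n}) x0 a b : x0 \in [:: xplus X; xminus X] ->
  a != b -> ~~ rnoX X (x0, a, b).
Proof.
rewrite !inE => x0E ab; have x0ab : x0 a != x0 b by rewrite (inj_eq perm_inj).
case/orP: x0E => /eqP x0E; apply/forallPn.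
  (* From [xplus], the upper right square of the rectangle carries an X; its column is the one left
     of line [b]. *)
  exists (ord_pred b); rewrite negbK /rsq /rsrc /rleft /rright /=.
  have xb : x0 b = ordS (X (ord_pred b)) by rewrite x0E permE.
  apply/andP; split; last by rewrite xb cyc_in_right // -xb.
  by have := @cyc_in_right _ a (ord_pred b); rewrite ord_predK; apply.
(* From [xminus], it is the lower left square. *)
exists a; rewrite negbK /rsq /rsrc /rleft /rright /= cyc_in_left //=.
by rewrite -[X a]/(xminus X a) -x0E cyc_in_left.
Qed.

Theorem theorem1p5 (n : nat) (Xr Or : {perm 'I_n}) (S : rect n -> int) :
  is_grid Xr Or -> is_knot Xr Or -> sign_assignment S ->
  forall x0, x0 \in [:: xplus Xr; xminus Xr] ->
    diffCK Xr Or S (gen_chain 1 x0) = (fun _ => 0) /\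
    forall (i : 'I_n) (d : nat),
      ~ is_boundary Xr Or S (gen_chain ('X_i ^+ d) x0).
Proof.
move=> _ _ [S1 _ _ _] x0 x0E; split.
  apply: functional_extensionality => y.
  rewrite /diffCK; apply: big1 => x _; apply: big1 => a _; apply: big1 => b /and4P[ab _ noX _].
  rewrite /gen_chain; case: eqP => [xx0|]; rewrite ?mulr0 //.
  by move: noX; rewrite xx0 (negPf (no_outgoing x0E ab)).
(* For [n = 0] there is no variable [U_i]; the symmetries require a successor. *)
move=> i d; case: n Xr Or S S1 x0 x0E i => [|n] X O S S1 x0 x0E i; first by case: i.
have [phi phi0 phi1] : exists2 phi, forall x, cobd X pred0 phi x = 0 & phi x0 = 1.
  by move: x0E; rewrite !inE => /orP[] /eqP ->; [exact: xplus_cocycle | exact: xminus_cocycle].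
apply: (not_boundary S1 phi0 phi1) => [|y yx0].
  by rewrite /gen_chain eqxx /reduce rmorphXn /= mevalXU expr1n.
by rewrite /gen_chain (negPf yx0).
Qed.
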